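(* Let $n\geq 2$ be an integer and let $\langle\cdot,\cdot\rangle_\star$ be a non-degenerate Hermitian form on $\mathbb C^n$ of arbitrary (possibly indefinite) signature. Write $\|z\|_\star^2:=\langle z,z\rangle_\star$. Let $\kappa_0$ be the largest $\kappa\in\mathbb N$ such that $n\geq(\kappa+2)(\kappa+1)$. Let $A(z,\bar z)\in\mathbb C[z_1,\ldots,z_n,\bar z_1,\ldots,\bar z_n]$ be a non-zero Hermitian polynomial, where $z=(z_1,\ldots,z_n)$, and let $R$ be the rank of $A(z,\bar z)\|z\|_\star^2$. Then either $$R\geq(\kappa_0+1)n-(\kappa_0+1)\kappa_0,$$ or there exists $\kappa\in\{1,\ldots,\kappa_0\}$ such that $$\kappa n-\kappa(\kappa-1)\leq R\leq\kappa n+2\kappa.$$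
   Context: $\mathbb N$ denotes the non-negative integers (including $0$); if $\kappa_0=0$ the set $\{1,\ldots,\kappa_0\}$ is empty. A polynomial $P(z,\bar z)\in\mathbb C[z_1,\ldots,z_n,\bar z_1,\ldots,\bar z_n]$ is called Hermitian if it is real valued. Every Hermitian polynomial $P(z,\bar z)$ can be written as $P(z,\bar z)=|P_1^+(z)|^2+\cdots+|P_p^+(z)|^2-|P_1^-(z)|^2-\cdots-|P_q^-(z)|^2$ with $P_1^+,\ldots,P_p^+,P_1^-,\ldots,P_q^-$ linearly independent holomorphic polynomials in $z$; the number $p+q$ is uniquely determined by $P$ and is called the rank of $P$ (equivalently, it is the rank of the Hermitian matrix of coefficients $(c_{\alpha\beta})$ in $P=\sum c_{\alpha\beta}z^\alpha\bar z^\beta$). *)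

(* Defs.v *)
From HB Require Import structures.
From mathcomp Require Import all_boot all_order all_algebra.
From mathcomp Require Import sesquilinear complex reals mpoly.

Set Implicit Arguments.
Unset Strict Implicit.
Unset Printing Implicit Defensive.

Import Order.TTheory GRing.Theory Num.Theory.

Local Open Scope ring_scope.

(* An element of C[z_1, .., z_n, zb_1, .., zb_n] is a polynomial in n + n
   variables: index lshift n j stands for z_j and rshift n j for its conjugate
   variable zb_j. *)
Definition polarpt (C : numClosedFieldType) (n : nat) (z : 'rV[C]_n)
    (k : 'I_(n + n)) : C :=
  match split k with
  | inl j => z 0 j
  | inr j => (z 0 j)^*
  end.

Definition eval_zzbar (C : numClosedFieldType) (n : nat)
    (P : {mpoly C[n + n]}) (z : 'rV[C]_n) : C :=
  P.@[polarpt z].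

Definition eval_z (C : numClosedFieldType) (n : nat)
    (P : {mpoly C[n]}) (z : 'rV[C]_n) : C :=
  P.@[z 0].

Definition hermitian_poly (C : numClosedFieldType) (n : nat)
    (P : {mpoly C[n + n]}) : Prop :=
  forall z : 'rV[C]_n, eval_zzbar P z \is Num.real.

(* {mpoly C[n]} is infinite dimensional, so `free` of vector.v does not apply. *)
Definition lin_indep (K : fieldType) (V : lmodType K) (I : finType)
    (v : I -> V) : Prop :=
  forall c : I -> K, \sum_i c i *: v i = 0 -> forall i, c i = 0.

(* The linear independence is that of the concatenated family
   P_1^+, .., P_p^+, P_1^-, .., P_q^-. *)
Definition has_rank (C : numClosedFieldType) (n : nat)
    (P : {mpoly C[n + n]}) (r : nat) : Prop :=
  exists (p q : nat) (Pp : 'I_p -> {mpoly C[n]}) (Pm : 'I_q -> {mpoly C[n]}),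
    [/\ r = (p + q)%N,
        lin_indep (fun i : 'I_p + 'I_q =>
                     match i with inl a => Pp a | inr b => Pm b end)
      & forall z : 'rV[C]_n,
          eval_zzbar P z = \sum_(a < p) `|eval_z (Pp a) z| ^+ 2
                         - \sum_(b < q) `|eval_z (Pm b) z| ^+ 2].

Definition sqnorm_poly (C : numClosedFieldType) (n : nat)
    (herm : {hermitian 'rV[C]_n for false & Num.conj}) : {mpoly C[n + n]} :=
  \sum_(i < n) \sum_(j < n)
     herm 'e_i 'e_j *: ('X_(lshift n i) * 'X_(rshift n j)).

Lemma eval_sqnorm_poly (C : numClosedFieldType) (n : nat)
    (herm : {hermitian 'rV[C]_n for false & Num.conj}) (z : 'rV[C]_n) :
  eval_zzbar (sqnorm_poly herm) z = herm z z.
Proof.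
have polarl i : polarpt z (lshift n i) = z 0 i.
  by rewrite /polarpt -[lshift n i]/(unsplit (inl i)) unsplitK.
have polarr i : polarpt z (rshift n i) = (z 0 i)^*.
  by rewrite /polarpt -[rshift n i]/(unsplit (inr i)) unsplitK.
transitivity (\sum_i \sum_j z 0 i * ((z 0 j)^* * herm 'e_i 'e_j)).
  rewrite /eval_zzbar /sqnorm_poly raddf_sum; apply: eq_bigr => i _ /=.
  rewrite raddf_sum; apply: eq_bigr => j _ /=.
  by rewrite mevalZ mevalM !mevalXU polarl polarr mulrC -mulrA.
rewrite [X in _ = herm X _](row_sum_delta z) linear_sumlz.
apply: eq_bigr => i _; rewrite linearZl_LR.
rewrite [X in _ = _ * herm _ X](row_sum_delta z) linear_sumr mulr_sumr.
by apply: eq_bigr => j _; rewrite linearZr_LR.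
Qed.

(* Main.v *)
(* Write A * <z, z> = F(z) . G(w) with w = conj z, where F lists the polynomials
   of a decomposition of rank r and G their conjugates up to sign, and let s(j)
   be the dimension of the span of F on a generic j-dimensional subspace, so
   that s(n) = r. By polarization F(L) is orthogonal to G of the orthogonal
   complement of L, hence s(a) + s(b) <= s(n) whenever a + b = n. On the other hand,
   a jump s(m) - s(m - 1) >= k means that many functions of the span are
   divisible by the equation of a hyperplane; restricting these to generic
   subspaces gives s(i) - s(i - 1) >= min(k, i) for all i <= m, hence
   s(j) >= sum_(i <= j) min(k, i) for all j <= m. These two
   properties of s imply, for every k, that r <= k n or r >= (k + 1) (n - k). *)

Require Import Defs.
From mathcomp Require Import all_boot all_order all_algebra.
From mathcomp Require Import sesquilinear complex reals mpoly.
From mathcomp Require Import boolp zify ring.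

Import Order.TTheory GRing.Theory Num.Theory.

Local Open Scope ring_scope.

Set Implicit Arguments.
Unset Strict Implicit.
Unset Printing Implicit Defensive.

(** * Maxima of predicates on a bounded range of integers *)

Section MaxBelow.

(** The predicates of interest quantify over all matrices, so membership is decided classically; the
    value is 0 when no integer up to [N] satisfies [P]. *)
Definition max_below (N : nat) (P : nat -> Prop) : nat :=
  \max_(r < N.+1 | `[< P r >]) r.

Lemma max_below_ge N (P : nat -> Prop) r :
  (r <= N)%N -> P r -> (r <= max_below N P)%N.
Proof.
move=> rN Pr; rewrite -[r]/(val (Ordinal (rN : r < N.+1)%N)).
by apply: leq_bigmax_cond; apply/asboolP.
Qed.

Lemma max_belowP N (P : nat -> Prop) r :
  (r <= N)%N -> P r -> P (max_below N P).
Proof.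
move=> rN Pr.
have [|i Pi] := @eq_bigmax_cond 'I_N.+1 (fun i => `[< P i >]) (@nat_of_ord _).
  by apply/card_gt0P; exists (Ordinal (rN : r < N.+1)%N); apply/asboolP.
by rewrite /max_below => ->; apply/asboolP.
Qed.

End MaxBelow.

(** * Row spaces: extension to free families and to bases *)

Section RowSpaces.

Variable K : fieldType.

(** The first [k] rows of the invertible matrix [row_ebase A] are free, and the first [\rank A] of
    them already span the row space of [A]. *)
Lemma sub_row_free (p k m : nat) (A : 'M[K]_(p, m)) :
  (\rank A <= k)%N -> (k <= m)%N ->
  exists2 B : 'M[K]_(k, m), row_free B & (A <= B)%MS.
Proof.
move=> rk km; exists (pid_mx k *m row_ebase A).
  rewrite /row_free mxrankMfree ?row_free_unit ?row_ebase_unit //.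
  by rewrite rank_pid_mx // leqnn.
rewrite -[A in X in (X <= _)%MS]mulmx_ebase.
have -> : (pid_mx (\rank A) : 'M[K]_(p, m)) =
          (pid_mx (\rank A) : 'M_(p, k)) *m (pid_mx k : 'M_(k, m)).
  by rewrite mul_pid_mx; congr pid_mx; lia.
by rewrite !mulmxA -mulmxA submxMl.
Qed.

Lemma sub_eqmx (p k m : nat) (A : 'M[K]_(p, m)) :
  (\rank A <= k)%N -> exists B : 'M[K]_(k, m), (B :=: A)%MS.
Proof.
move=> rk; exists (pid_mx (\rank A) *m row_base A).
apply/eqmxP; apply/andP; split.
  by apply: submx_trans (submxMl _ _) _; rewrite eq_row_base.
rewrite -{1}(eq_row_base A).
have {1}-> : row_base A =
    (pid_mx (\rank A) : 'M_(_, k)) *m (pid_mx (\rank A) *m row_base A).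
  by rewrite mulmxA pid_mx_id // pid_mx_1 mul1mx.
exact: submxMl.
Qed.

Lemma row_free_col_mx (a b : nat) (A : 'M[K]_(b, a + b)) : row_free A ->
  exists B : 'M[K]_(a, a + b), col_mx B A \in unitmx.
Proof.
move=> freeA; have [|B eqB] := @sub_eqmx _ a _ (A^C)%MS.
  by rewrite mxrank_compl (eqP freeA) addnK.
exists B; rewrite -row_full_unit -sub1mx -addsmxE addsmxC.
by rewrite (adds_eqmx (eqmx_refl A) eqB) sub1mx addsmx_compl_full.
Qed.

End RowSpaces.

(** * The span of the values of a map on a subspace *)

Section ImageRank.

Variables (K : fieldType) (n N : nat) (F : 'rV[K]_n -> 'rV[K]_N).

Definition map_rows p (X : 'M[K]_(p, n)) : 'M[K]_(p, N) :=
  \matrix_i F (row i X).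

Lemma row_map_rows p (X : 'M[K]_(p, n)) i : row i (map_rows X) = F (row i X).
Proof. by rewrite rowK. Qed.

Lemma map_rows_sub p q (X : 'M[K]_(p, n)) (B : 'M[K]_(q, N)) :
  (forall v, (v <= X)%MS -> (F v <= B)%MS) -> (map_rows X <= B)%MS.
Proof.
by move=> h; apply/row_subP => i; rewrite row_map_rows h // row_sub.
Qed.

(* The dimension of the span of [F v] for [v] in the row space of [M]. *)
Definition img_rank m (M : 'M[K]_(m, n)) : nat :=
  max_below N (fun r => exists p (Y : 'M[K]_(p, m)),
                          \rank (map_rows (Y *m M)) = r).

Lemma img_rank_ge p m (X : 'M[K]_(p, n)) (M : 'M[K]_(m, n)) :
  (X <= M)%MS -> (\rank (map_rows X) <= img_rank M)%N.
Proof.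
move=> /submxP[Y ->]; apply: max_below_ge; first exact: rank_leq_col.
by exists p, Y.
Qed.

(** Adjoining a vector [v] of the subspace to a family of maximal rank cannot raise the rank, so
    [F v] already lies in the span of the values on that family. *)
Lemma img_rankP m (M : 'M[K]_(m, n)) :
  exists p (X : 'M[K]_(p, n)),
    [/\ (X <= M)%MS, \rank (map_rows X) = img_rank M
      & forall v, (v <= M)%MS -> (F v <= map_rows X)%MS].
Proof.
have [p [Y rY]] : exists p (Y : 'M[K]_(p, m)),
    \rank (map_rows (Y *m M)) = img_rank M.
  pose P r := exists p (Y : 'M[K]_(p, m)), \rank (map_rows (Y *m M)) = r.
  apply: (@max_belowP N P 0) => //.
  by exists 0%N, 0; apply/eqP; rewrite -leqn0; apply: rank_leq_row.
exists p, (Y *m M); split => // [|v vM]; first exact: submxMl.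
have sub0 : (map_rows (Y *m M) <= map_rows (col_mx v (Y *m M)))%MS.
  apply/row_subP => i.
  by rewrite row_map_rows -(rowKd _ v) -row_map_rows row_sub.
have vsub : (F v <= map_rows (col_mx v (Y *m M)))%MS.
  have -> : v = row (lshift p (0 : 'I_1)) (col_mx v (Y *m M)).
    by rewrite rowKu row_id.
  by rewrite -row_map_rows rowKu row_id row_sub.
apply: submx_trans vsub _.
rewrite -(mxrank_leqif_sup sub0) eqn_leq mxrankS //= rY.
by apply: img_rank_ge; rewrite col_mx_sub vM submxMl.
Qed.

End ImageRank.

(** * The rank on a generic subspace of given dimension *)

Section GenericRank.

Variable K : fieldType.

Section Fixed.

Variables (n N : nat) (F : 'rV[K]_n -> 'rV[K]_N).

Lemma img_rank_le m q (M : 'M[K]_(m, n)) (B : 'M[K]_(q, N)) :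
  (forall v, (v <= M)%MS -> (F v <= B)%MS) -> (img_rank F M <= \rank B)%N.
Proof.
move=> FB; have [p [X [XM <- _]]] := img_rankP F M.
by apply/mxrankS/map_rows_sub => v vX; apply/FB/(submx_trans vX).
Qed.

Lemma img_rank_leq_col m (M : 'M[K]_(m, n)) : (img_rank F M <= N)%N.
Proof. by have [p [X [_ <- _]]] := img_rankP F M; apply: rank_leq_col. Qed.

Lemma img_rankS m1 m2 (M1 : 'M[K]_(m1, n)) (M2 : 'M[K]_(m2, n)) :
  (M1 <= M2)%MS -> (img_rank F M1 <= img_rank F M2)%N.
Proof.
move=> M12; have [p [X [XM <- _]]] := img_rankP F M1.
by apply/img_rank_ge/(submx_trans XM).
Qed.

(* The dimension of the span of [F] on a generic [j]-dimensional subspace. *)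
Definition gen_rank (j : nat) : nat :=
  max_below N (fun r => exists M : 'M[K]_(j, n), img_rank F M = r).

Lemma gen_rank_ge j (M : 'M[K]_(j, n)) : (img_rank F M <= gen_rank j)%N.
Proof. by apply: max_below_ge; [apply: img_rank_leq_col | exists M]. Qed.

Lemma gen_rankP j : exists M : 'M[K]_(j, n), img_rank F M = gen_rank j.
Proof.
pose P r := exists M : 'M[K]_(j, n), img_rank F M = r.
apply: (@max_belowP N P (img_rank F (0 : 'M_(j, n)))); last by exists 0.
exact: img_rank_leq_col.
Qed.

End Fixed.

Lemma gen_rank_full n N (F : 'rV[K]_n -> 'rV[K]_N) :
  gen_rank F n = img_rank F 1%:M.
Proof.
apply/eqP; rewrite eqn_leq gen_rank_ge andbT.
by have [M <-] := gen_rankP F n; apply/img_rankS/submx1.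
Qed.

Lemma img_rank_comp n m p N (F : 'rV[K]_n -> 'rV[K]_N)
    (A : 'M[K]_(m, n)) (M : 'M[K]_(p, m)) :
  img_rank (fun v => F (v *m A)) M = img_rank F (M *m A).
Proof.
apply/eqP; rewrite eqn_leq; apply/andP; split.
  have [q [X [_ <- FX]]] := img_rankP F (M *m A).
  by apply: img_rank_le => v vM; apply/FX/submxMr.
have [q [X [_ <- FX]]] := img_rankP (fun v => F (v *m A)) M.
by apply: img_rank_le => v /submxP[D ->]; rewrite mulmxA; apply/FX/submxMl.
Qed.

Lemma gen_rank_comp_le n m N (F : 'rV[K]_n -> 'rV[K]_N) (A : 'M[K]_(m, n)) j :
  (gen_rank (fun v => F (v *m A)) j <= gen_rank F j)%N.
Proof.
have [M <-] := gen_rankP (fun v => F (v *m A)) j.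
by rewrite img_rank_comp gen_rank_ge.
Qed.

(** Growth at the top means that the values on a hyperplane never span all values. Extend an optimal
    [V] with [i] rows to a hyperplane [H] and choose [v] with [F v] outside the span over [H]:
    adjoining [v] to [V] raises the rank. *)
Lemma gen_rank_lt_strict m N (F : 'rV[K]_m.+1 -> 'rV[K]_N) :
  (gen_rank F m < gen_rank F m.+1)%N ->
  forall i, (i <= m)%N -> (gen_rank F i < gen_rank F i.+1)%N.
Proof.
move=> ltm i im; have [V rV] := gen_rankP F i.
have [H _ VH] : exists2 H : 'M[K]_(m, m.+1), row_free H & (V <= H)%MS.
  by apply: sub_row_free => //; apply: leq_trans (rank_leq_row _) im.
have [q [X [_ rX FX]]] := img_rankP F H.
have [v vX] : exists v, ~~ (F v <= map_rows F X)%MS.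
  apply: contrapT => nex; move: ltm.
  rewrite gen_rank_full ltnNge => /negP; apply.
  apply: leq_trans (gen_rank_ge F H); rewrite -rX.
  by apply: img_rank_le => v _; apply: contrapT => /negP vX; apply: nex; exists v.
have [p [Y [YV rY FY]]] := img_rankP F V.
apply: leq_trans (gen_rank_ge F (col_mx v V : 'M_(1 + i, _))).
have subY : (col_mx v Y <= col_mx v V)%MS.
  by rewrite -!addsmxE addsmxS.
apply: leq_trans (img_rank_ge F subY); rewrite -rV -rY.
have YvY : (map_rows F Y <= map_rows F (col_mx v Y))%MS.
  by apply/row_subP => k; rewrite row_map_rows -(rowKd _ v) -row_map_rows row_sub.
rewrite ltn_neqAle mxrankS // andbT (mxrank_leqif_sup YvY).
apply: contra vX => vY; apply: (@submx_trans _ _ _ _ _ _ (map_rows F Y)).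
  apply: submx_trans vY.
  have {1}-> : v = row (lshift p (0 : 'I_1)) (col_mx v Y) by rewrite rowKu row_id.
  by rewrite -row_map_rows row_sub.
by apply: map_rows_sub => w wY; apply/FX/(submx_trans wY)/(submx_trans YV).
Qed.

Lemma gen_rank_ge_index m N (F : 'rV[K]_m.+1 -> 'rV[K]_N) :
  (gen_rank F m < gen_rank F m.+1)%N ->
  forall i, (i <= m.+1)%N -> (i <= gen_rank F i)%N.
Proof.
move=> /gen_rank_lt_strict lt; elim=> // i IHi im.
by apply: leq_ltn_trans (IHi (ltnW im)) (lt _ im).
Qed.

End GenericRank.

(** * Polynomial functions and curves, and genericity along curves *)

Section PolynomialFunctions.

Variable K : numFieldType.

Definition polyfun (f : K -> K) : Prop :=
  exists p : {poly K}, forall t, f t = p.[t].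

Lemma eq_polyfun f g : f =1 g -> polyfun f -> polyfun g.
Proof. by move=> fg [p fp]; exists p => t; rewrite -fg. Qed.

Lemma polyfun_cst c : polyfun (fun _ => c).
Proof. by exists c%:P => t; rewrite hornerC. Qed.

Lemma polyfun_id : polyfun id.
Proof. by exists 'X => t; rewrite hornerX. Qed.

Lemma polyfunD f g : polyfun f -> polyfun g -> polyfun (fun t => f t + g t).
Proof. by move=> [p fp] [q gq]; exists (p + q) => t; rewrite fp gq hornerD. Qed.

Lemma polyfunM f g : polyfun f -> polyfun g -> polyfun (fun t => f t * g t).
Proof. by move=> [p fp] [q gq]; exists (p * q) => t; rewrite fp gq hornerM. Qed.

Lemma polyfunN f : polyfun f -> polyfun (fun t => - f t).
Proof. by move=> [p fp]; exists (- p) => t; rewrite fp hornerN. Qed.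

Lemma polyfunX f k : polyfun f -> polyfun (fun t => f t ^+ k).
Proof. by move=> [p fp]; exists (p ^+ k) => t; rewrite fp horner_exp. Qed.

Lemma polyfun_sum (I : Type) (r : seq I) (P : pred I) (f : I -> K -> K) :
  (forall i, polyfun (f i)) -> polyfun (fun t => \sum_(i <- r | P i) f i t).
Proof.
move=> fP; elim: r => [|i r IHr].
  by apply: eq_polyfun (polyfun_cst 0) => t; rewrite big_nil.
case Pi: (P i); last by apply: eq_polyfun IHr => t; rewrite big_cons Pi.
by apply: eq_polyfun (polyfunD (fP i) IHr) => t; rewrite big_cons Pi.
Qed.

Lemma polyfun_prod (I : Type) (r : seq I) (P : pred I) (f : I -> K -> K) :
  (forall i, polyfun (f i)) -> polyfun (fun t => \prod_(i <- r | P i) f i t).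
Proof.
move=> fP; elim: r => [|i r IHr].
  by apply: eq_polyfun (polyfun_cst 1) => t; rewrite big_nil.
case Pi: (P i); last by apply: eq_polyfun IHr => t; rewrite big_cons Pi.
by apply: eq_polyfun (polyfunM (fP i) IHr) => t; rewrite big_cons Pi.
Qed.

Lemma nonzero_horner_nat (p : {poly K}) :
  p != 0 -> exists k : nat, p.[k%:R] != 0.
Proof.
move=> p0; apply: contrapT => nex.
pose rs := [seq k%:R : K | k <- iota 0 (size p)].
suff : (size rs < size p)%N by rewrite size_map size_iota ltnn.
apply: (max_poly_roots p0).
  apply/allP => _ /mapP[k _ ->]; apply/rootP; apply: contrapT => /eqP pk.
  by apply: nex; exists k.
by rewrite map_inj_uniq ?iota_uniq // => i j /eqP; rewrite eqr_nat => /eqP.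
Qed.

(** A nonzero polynomial has fewer roots than there are natural numbers. Polarization relies on
    these parameters being fixed by conjugation. *)
Lemma polyfun_eq0 f :
  polyfun f -> (forall k : nat, f k%:R = 0) -> forall t, f t = 0.
Proof.
move=> [p fp] f0 t; rewrite fp.
have [->|/nonzero_horner_nat[k]] := eqVneq p 0; first by rewrite horner0.
by rewrite -fp f0 eqxx.
Qed.

Lemma polyfun_common_nonroot f g s t : polyfun f -> polyfun g ->
  f s != 0 -> g t != 0 -> exists u, (f u != 0) && (g u != 0).
Proof.
move=> [p fp] [q gq]; rewrite fp gq => ps qt.
have nz0 (r : {poly K}) x : r.[x] != 0 -> r != 0.
  by apply: contraNneq => ->; rewrite horner0.
have [|k] := @nonzero_horner_nat (p * q).
  by rewrite mulf_neq0 ?(nz0 _ _ ps) ?(nz0 _ _ qt).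
by rewrite hornerM mulf_eq0 negb_or -fp -gq; exists k%:R.
Qed.

Definition polycurve m n (X : K -> 'M[K]_(m, n)) : Prop :=
  forall i j, polyfun (fun t => X t i j).

Lemma polycurve_cst m n (A : 'M[K]_(m, n)) : polycurve (fun _ => A).
Proof. by move=> i j; apply: polyfun_cst. Qed.

Lemma polycurveD m n (X Y : K -> 'M[K]_(m, n)) :
  polycurve X -> polycurve Y -> polycurve (fun t => X t + Y t).
Proof.
move=> XP YP i j; apply: eq_polyfun (polyfunD (XP i j) (YP i j)) => t.
by rewrite mxE.
Qed.

Lemma polycurveZ m n (X : K -> 'M[K]_(m, n)) f :
  polyfun f -> polycurve X -> polycurve (fun t => f t *: X t).
Proof.
move=> fP XP i j; apply: eq_polyfun (polyfunM fP (XP i j)) => t.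
by rewrite mxE.
Qed.

Lemma polycurveM m n p (X : K -> 'M[K]_(m, n)) (Y : K -> 'M[K]_(n, p)) :
  polycurve X -> polycurve Y -> polycurve (fun t => X t *m Y t).
Proof.
move=> XP YP i j.
apply: eq_polyfun (polyfun_sum _ _ (fun k => polyfunM (XP i k) (YP k j))) => t.
by rewrite mxE.
Qed.

Lemma polycurve_tr m n (X : K -> 'M[K]_(m, n)) :
  polycurve X -> polycurve (fun t => (X t)^T).
Proof. by move=> XP i j; apply: eq_polyfun (XP j i) => t; rewrite mxE. Qed.

Lemma polycurve_sub m n m' n' (f : 'I_m' -> 'I_m) (g : 'I_n' -> 'I_n)
    (X : K -> 'M[K]_(m, n)) :
  polycurve X -> polycurve (fun t => mxsub f g (X t)).
Proof. by move=> XP i j; apply: eq_polyfun (XP (f i) (g j)) => t; rewrite mxE. Qed.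

Lemma polycurve_col_mx m1 m2 n (X : K -> 'M[K]_(m1, n)) (Y : K -> 'M[K]_(m2, n)) :
  polycurve X -> polycurve Y -> polycurve (fun t => col_mx (X t) (Y t)).
Proof.
move=> XP YP i j; case: (split_ordP i) => k ->.
  by apply: eq_polyfun (XP k j) => t; rewrite col_mxEu.
by apply: eq_polyfun (YP k j) => t; rewrite col_mxEd.
Qed.

Lemma polyfun_det n (X : K -> 'M[K]_n) :
  polycurve X -> polyfun (fun t => \det (X t)).
Proof.
move=> XP; apply: polyfun_sum => s; apply: polyfunM; first exact: polyfun_cst.
by apply: polyfun_prod => i; apply: XP.
Qed.

Lemma polycurve_adj n (X : K -> 'M[K]_n) :
  polycurve X -> polycurve (fun t => \adj (X t)).
Proof.
move=> XP i j.
apply: (@eq_polyfun (fun t => cofactor (X t) j i)) => [t|]; first by rewrite mxE.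
apply: polyfunM; first exact: polyfun_cst.
apply: polyfun_det => k l; apply: eq_polyfun (XP (lift j k) (lift i l)) => t.
by rewrite !mxE.
Qed.

Definition polymap n N (F : 'rV[K]_n -> 'rV[K]_N) : Prop :=
  forall j, exists p : {mpoly K[n]}, forall v, F v 0 j = p.@[v 0].

Lemma polyfun_meval n (p : {mpoly K[n]}) (x : K -> 'I_n -> K) :
  (forall i, polyfun (fun t => x t i)) -> polyfun (fun t => p.@[x t]).
Proof.
move=> xP.
apply: (@eq_polyfun (fun t => \sum_(m <- msupp p) p@_m * \prod_i x t i ^+ m i)).
  by move=> t; rewrite mevalE.
apply: polyfun_sum => m; apply: polyfunM; first exact: polyfun_cst.
by apply: polyfun_prod => i; apply: polyfunX.
Qed.

Lemma polymap_curve n N (F : 'rV[K]_n -> 'rV[K]_N) (x : K -> 'rV[K]_n) :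
  polymap F -> polycurve x -> polycurve (fun t => F (x t)).
Proof.
move=> FP xP i j; rewrite ord1; have [p Fp] := FP j.
apply: (eq_polyfun (fun t => esym (Fp (x t)))).
by apply: polyfun_meval => k; apply: xP.
Qed.

Lemma polymap_mulr n N N' (F : 'rV[K]_n -> 'rV[K]_N) (D : 'M[K]_(N, N')) :
  polymap F -> polymap (fun v => F v *m D).
Proof.
move=> FP j; have [p Fp] := choice FP.
exists (\sum_i D i j *: p i) => v; rewrite mxE raddf_sum; apply: eq_bigr => i _ /=.
by rewrite mevalZ Fp mulrC.
Qed.

Lemma polymap_mull n m N (F : 'rV[K]_n -> 'rV[K]_N) (A : 'M[K]_(m, n)) :
  polymap F -> polymap (fun v => F (v *m A)).
Proof.
move=> FP j; have [p Fp] := FP j.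
exists (p \mPo [tuple \sum_i A i k *: 'X_i | k < n]) => v.
rewrite comp_mpoly_meval Fp; apply: meval_eq => k.
rewrite tnth_mktuple mxE raddf_sum; apply: eq_bigr => i _ /=.
by rewrite mevalZ mevalXU mulrC.
Qed.

(* Lower semicontinuity of the image rank along a curve, witnessed by a
   minor. *)
Lemma img_rank_minor m n N (F : 'rV[K]_n -> 'rV[K]_N)
    (X : K -> 'M[K]_(m, n)) s : polymap F -> polycurve X ->
  exists f, [/\ polyfun f, f s != 0 &
    forall t, f t != 0 -> (img_rank F (X s) <= img_rank F (X t))%N].
Proof.
move=> FP XP; have [p [_ [/submxP[Y ->] <- _]]] := img_rankP F (X s).
set B := map_rows F (Y *m X s).
have [L LB] : exists L, L *m col_base B = 1%:M.
  by apply/row_fullP; rewrite col_base_full.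
have [R BR] : exists R, row_base B *m R = 1%:M.
  by apply/row_freeP; rewrite row_base_free.
(* Compressing by [L] and [R] replaces the choice of a minor: the determinant is 1 at [s], and where
   it is nonzero the rank is at least [\rank B]. *)
pose f t := \det (L *m map_rows F (Y *m X t) *m R).
exists f; split=> [||t ft].
- apply: polyfun_det; apply: polycurveM (polycurve_cst R).
  apply: polycurveM (polycurve_cst L) _ => i j.
  have YXP : polycurve (fun t => row i (Y *m X t)).
    by apply: polycurve_sub; apply: polycurveM XP; apply: polycurve_cst.
  by apply: eq_polyfun (polymap_curve FP YXP 0 j) => t; rewrite !mxE.
- have -> : f s = \det (L *m (col_base B *m row_base B) *m R).
    by rewrite mulmx_base.
  by rewrite mulmxA LB mul1mx BR det1 oner_neq0.
- have /mulmxV : L *m map_rows F (Y *m X t) *m R \in unitmx.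
    by rewrite unitmxE unitfE.
  rewrite -(mulmxA _ R) => /mulmx1_min_rank r_le.
  by apply: leq_trans r_le _; apply/img_rank_ge/submxMl.
Qed.

(** Each condition fails only at the roots of a nonzero polynomial. Hence two optimal
    configurations, reached at different parameters, can be matched at a single one. *)
Lemma img_rank_common m1 m2 n1 n2 N1 N2
    (F1 : 'rV[K]_n1 -> 'rV[K]_N1) (F2 : 'rV[K]_n2 -> 'rV[K]_N2)
    (X1 : K -> 'M[K]_(m1, n1)) (X2 : K -> 'M[K]_(m2, n2)) s1 s2 :
  polymap F1 -> polymap F2 -> polycurve X1 -> polycurve X2 ->
  exists t, (img_rank F1 (X1 s1) <= img_rank F1 (X1 t))%N /\
            (img_rank F2 (X2 s2) <= img_rank F2 (X2 t))%N.
Proof.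
move=> F1P F2P X1P X2P.
have [f [fP fs le1]] := img_rank_minor s1 F1P X1P.
have [g [gP gs le2]] := img_rank_minor s2 F2P X2P.
have [t /andP[ft gt]] := polyfun_common_nonroot fP gP fs gs.
by exists t; split; [apply: le1 | apply: le2].
Qed.

End PolynomialFunctions.

(** * How a jump of the generic rank propagates to smaller dimensions *)

Section GenericRankConcavity.

Variable K : numFieldType.

(** Rank-nullity for [D] on the span of [F] over [M]: the kernel contains the span over [M0]. *)
Lemma img_rank_quotient m0 m n N N' (F : 'rV[K]_n -> 'rV[K]_N)
    (D : 'M[K]_(N, N')) (M0 : 'M[K]_(m0, n)) (M : 'M[K]_(m, n)) :
  (M0 <= M)%MS -> (forall v, (v <= M0)%MS -> F v *m D = 0) ->
  (img_rank F M0 + img_rank (fun v => F v *m D) M <= img_rank F M)%N.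
Proof.
move=> M0M FD0; have [p0 [X0 [X0M <- _]]] := img_rankP F M0.
have [p [X [_ <- FX]]] := img_rankP F M.
set S0 := map_rows F X0; set S := map_rows F X.
rewrite -(mxrank_mul_ker S D) addnC leq_add //.
  by apply: img_rank_le => v vM; apply/submxMr/FX.
apply: mxrankS; rewrite sub_capmx; apply/andP; split.
  by apply: map_rows_sub => v vX0; apply/FX/(submx_trans vX0)/(submx_trans X0M).
apply: map_rows_sub => v vX0; apply/sub_kermxP/FD0.
exact: submx_trans vX0 X0M.
Qed.

(** The kernel of [cokermx B] is the row space of [B], so passing to the quotient loses at most
    [\rank B]. *)
Lemma img_rank_coker m n N p (F : 'rV[K]_n -> 'rV[K]_N) (B : 'M[K]_(p, N))
    (M : 'M[K]_(m, n)) :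
  (img_rank F M <= \rank B + img_rank (fun v => F v *m cokermx B) M)%N.
Proof.
have [q [X [XM <- _]]] := img_rankP F M.
rewrite -(mxrank_mul_ker (map_rows F X) (cokermx B)) addnC leq_add //.
  apply: leq_trans (mxrankS (capmxSr _ _)) _.
  by rewrite mxrank_ker mxrank_coker subKn // rank_leq_col.
apply: leq_trans (img_rank_ge _ XM); apply/mxrankS/row_subP => i.
rewrite row_mul row_map_rows.
by rewrite -[F _ *m _](row_map_rows (fun v => F v *m _)) row_sub.
Qed.

(** The intersection of [M] with [H] has dimension at most [m] and is written [T *m H]; a complement
    of it in [M] has dimension at most 1 and is spanned by [h]. *)
Lemma hyperplane_section m (H M : 'M[K]_(m.+1, m.+2)) :
  row_free H -> ~~ (M <= H)%MS ->
  exists (T : 'M[K]_(m, m.+1)) (h : 'rV[K]_m.+2),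
    (M <= col_mx h (T *m H))%MS.
Proof.
move=> /eqP rH MH.
have [|Y eqY] := @sub_eqmx _ _ m _ (M :&: H)%MS.
  rewrite -ltnS; apply: leq_trans (rank_leq_row M).
  rewrite ltn_neqAle mxrankS ?capmxSl // andbT.
  rewrite (mxrank_leqif_sup (capmxSl M H)).
  by apply: contra MH => /submx_trans; apply; apply: capmxSr.
have /submxP[T eqT] : (Y <= H)%MS by rewrite eqY capmxSr.
have [|h eqh] := @sub_eqmx _ _ 1 _ (M :\: H)%MS.
  have := mxrank_sum_cap M H; have := mxrank_cap_compl M H.
  by rewrite rH; have := rank_leq_col (M + H)%MS; lia.
exists T, h; rewrite -eqT -addsmxE (adds_eqmx eqh eqY).
by rewrite addsmx_diff_cap_eq.
Qed.

(* The functions [G] vanishing on a hyperplane [H] still span a large space on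
   a generic hyperplane [H']: either nothing is lost, or [gen_rank_ge_index]
   applies to [G]. They all vanish on the intersection of [H] and [H']. *)
Lemma gen_rank_step m N (F : 'rV[K]_m.+2 -> 'rV[K]_N) k :
  polymap F -> (gen_rank F m.+1 + k <= gen_rank F m.+2)%N ->
  (gen_rank F m + minn k m.+1 <= gen_rank F m.+1)%N.
Proof.
move=> FP stepF; have [Y0 rY0] := gen_rankP F m.
have [H freeH Y0H] : exists2 H : 'M[K]_(m.+1, m.+2), row_free H & (Y0 <= H)%MS.
  by apply: sub_row_free => //; apply: leq_trans (rank_leq_row _) _.
have [p [X [_ rX FX]]] := img_rankP F H.
(* The columns of [D] span the linear forms that kill [F] on [H], so the coordinates of [G] span the
   functions vanishing on [H]. *)
set D := cokermx (map_rows F X); pose G v := F v *m D.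
have GH v : (v <= H)%MS -> G v = 0.
  by move=> /FX; rewrite submxE => /eqP.
have GP : polymap G by apply: polymap_mulr.
have kG : (k <= gen_rank G m.+2)%N.
  rewrite gen_rank_full -(leq_add2l (gen_rank F m.+1)).
  apply: leq_trans stepF _; rewrite gen_rank_full.
  apply: leq_trans (img_rank_coker F (map_rows F X) 1%:M) _.
  by rewrite leq_add2r rX gen_rank_ge.
have minG : (minn k m.+1 <= gen_rank G m.+1)%N.
  have [|ltG] := leqP (gen_rank G m.+2) (gen_rank G m.+1).
    by move/(leq_trans kG)/(leq_trans (geq_minl k m.+1)).
  by apply: leq_trans (geq_minr k m.+1) _; apply: gen_rank_ge_index.
have [T1 [h MTh]] : exists (T1 : 'M[K]_(m, m.+1)) (h : 'rV[K]_m.+2),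
    (gen_rank G m.+1 <= img_rank G (col_mx h (T1 *m H)))%N.
  have [M rM] := gen_rankP G m.+1; rewrite -rM.
  have [MH|MH] := boolP (M <= H)%MS.
    exists 0, 0; suff -> : img_rank G M = 0%N by [].
    apply/eqP; rewrite -leqn0 -(mxrank0 K 1 N); apply: img_rank_le => v vM.
    by rewrite GH ?(submx_trans vM) ?sub0mx.
  have [T1 [h Mh]] := hyperplane_section freeH MH.
  by exists T1, h; apply: img_rankS.
have /submxP[T0 eqT0] := Y0H.
(* The segment joins a subspace optimal for [F] at 0 to a section by [H] of a subspace large for [G]
   at 1. It stays inside [H], so [G] vanishes on every [X1 t] and the two ranks add up. *)
pose X1 (t : K) := ((1 - t) *: T0 + t *: T1) *m H.
pose X2 (t : K) := col_mx (t *: h) (X1 t).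
have idP := polyfun_id K.
have X1P : polycurve X1.
  apply: polycurveM (polycurve_cst _); apply: polycurveD.
    apply: polycurveZ (polycurve_cst _).
    by apply: polyfunD (polyfun_cst _) _; apply: polyfunN.
  exact: polycurveZ (polycurve_cst _).
have X2P : polycurve X2.
  by apply: polycurve_col_mx => //; apply: polycurveZ (polycurve_cst _).
have [t [le1 le2]] := img_rank_common 0 1 FP GP X1P X2P.
move: le1 le2; rewrite /X2 /X1 subr0 subrr !scale1r !scale0r addr0 add0r.
rewrite -eqT0 rY0 -/(X1 t) -/(X2 t) => le1 le2.
apply: leq_trans (gen_rank_ge F (X2 t : 'M_(1 + m, _))).
apply: leq_trans (img_rank_quotient (D := D) _ (_ : forall v, (v <= X1 t)%MS -> _)).
- by rewrite leq_add // (leq_trans minG) // (leq_trans MTh).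
- by rewrite -addsmxE addsmxSr.
- by move=> v vX; apply: GH; apply: submx_trans vX (submxMl _ _).
Qed.

(** Induction on the dimension: [gen_rank_step] moves the jump one dimension down, and restricting
    [F] to an optimal hyperplane [M] makes that jump the top one again. The last term of the sum
    comes from the assumed jump itself. *)
Lemma gen_rank_sum_minn_full m N (F : 'rV[K]_m.+1 -> 'rV[K]_N) k :
  polymap F -> (gen_rank F m + k <= gen_rank F m.+1)%N ->
  forall j, (j <= m.+1)%N -> (\sum_(i < j) minn k i.+1 <= gen_rank F j)%N.
Proof.
elim: m F k => [|m IHm] F k FP stepF j.
  case: j => [|[|j]] // _; first by rewrite big_ord0.
  rewrite big_ord1; apply: leq_trans (geq_minl _ _) _.
  exact: leq_trans (leq_addl _ _) stepF.
suff IH i : (i <= m.+1)%N -> (\sum_(i0 < i) minn k i0.+1 <= gen_rank F i)%N.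
  rewrite leq_eqVlt => /predU1P[->|]; last exact: IH.
  rewrite big_ord_recr /=; apply: leq_trans stepF.
  by rewrite leq_add ?IH ?geq_minl.
move=> im; have [M rM] := gen_rankP F m.+1.
apply: leq_trans (gen_rank_comp_le F M i).
(* Here [i0.+1 <= m.+1], so capping [k] at [m.+1] changes no term. *)
rewrite (eq_bigr (fun i0 : 'I_i => minn (minn k m.+1) i0.+1)); last first.
  by move=> l _; have := ltn_ord l; lia.
apply: IHm => //; first exact: polymap_mull.
rewrite [leqRHS]gen_rank_full img_rank_comp mul1mx rM.
apply: leq_trans (gen_rank_step FP stepF).
by rewrite leq_add2r gen_rank_comp_le.
Qed.

Lemma gen_rank_sum_minn n m N (F : 'rV[K]_n -> 'rV[K]_N) k :
  polymap F -> (gen_rank F m + k <= gen_rank F m.+1)%N ->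
  forall j, (j <= m.+1)%N -> (\sum_(i < j) minn k i.+1 <= gen_rank F j)%N.
Proof.
move=> FP stepF j jm; have [M rM] := gen_rankP F m.+1.
apply: leq_trans (gen_rank_comp_le F M j).
apply: gen_rank_sum_minn_full (jm); first exact: polymap_mull.
rewrite [leqRHS]gen_rank_full img_rank_comp mul1mx rM.
by apply: leq_trans stepF; rewrite leq_add2r gen_rank_comp_le.
Qed.

End GenericRankConcavity.

(** * Superadditivity of generic ranks over orthogonal subspaces *)

Section Superadditivity.

Variable K : numFieldType.

(** It suffices to find orthogonal subspaces of dimensions [a] and [b] that are optimal for [F] and
    [G] simultaneously: the two value matrices then have product zero, which bounds the sum of their
    ranks by [N]. *)
Lemma gen_rank_orthogonal a b n N (F G : 'rV[K]_n -> 'rV[K]_N) (H : 'M[K]_n) :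
  (a + b)%N = n -> polymap F -> polymap G -> H \in unitmx ->
  (forall z w, z *m H *m w^T = 0 -> F z *m (G w)^T = 0) ->
  (gen_rank F a + gen_rank G b <= N)%N.
Proof.
move=> abn; case: n / abn in F G H * => FP GP uH FG0.
have [Z0 rZ0] := gen_rankP F a; have [W0 rW0] := gen_rankP G b.
have [W1 freeW1 W01] : exists2 W1 : 'M[K]_(b, a + b), row_free W1 & (W0 <= W1)%MS.
  by apply: sub_row_free; rewrite ?rank_leq_row ?leq_addl.
have [W2 uW] := row_free_col_mx freeW1; set W := col_mx W2 W1 in uW.
(* Orthogonal pairs are read off a square matrix [X]: its first [a] rows, and the last [b] columns
   of [invmx H *m \adj X]. The adjugate keeps the curve polynomial and the orthogonality valid for
   singular [X]. The first rows are [Z0] at 0; the last columns give a nonzero multiple of [W1] at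
   1. *)
pose X0 : 'M[K]_(a + b) := col_mx Z0 0; pose X1 := invmx (H *m W^T).
have uHW : H *m W^T \in unitmx by rewrite unitmx_mul uH unitmx_tr.
pose X (t : K) := (1 - t) *: X0 + t *: X1.
pose V t := invmx H *m \adj (X t).
pose Zt t := usubmx (X t); pose Wt t := dsubmx (V t)^T.
have XP : polycurve X.
  have idP := polyfun_id K.
  apply: polycurveD; apply: polycurveZ (polycurve_cst _) => //.
  by apply: polyfunD (polyfun_cst _) _; apply: polyfunN.
have ZP : polycurve Zt.
  move=> i j; apply: eq_polyfun (XP (lshift b i) j) => t.
  by rewrite [RHS]mxE.
have WP : polycurve Wt.
  have VP : polycurve V by apply: polycurveM (polycurve_cst _) (polycurve_adj XP).
  move=> i j; apply: eq_polyfun (VP j (rshift a i)) => t.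
  by rewrite [RHS]mxE [RHS]mxE.
have ZW0 t : Zt t *m H *m (Wt t)^T = 0.
  rewrite /Zt /Wt trmx_dsub trmxK mulmx_rsub !mul_usub_mx /V !mulmxA mulmxK //.
  by rewrite mul_mx_adj scalar_mx_block -[rsubmx _]/(ursubmx _) block_mxKur.
have [t [le1 le2]] := img_rank_common 0 1 FP GP ZP WP.
have W1Wt : (W1 <= Wt 1)%MS.
  rewrite /Wt /V /X subrr scale0r add0r scale1r.
  have uX1 : X1 \in unitmx by rewrite unitmx_inv.
  have -> : \adj X1 = \det X1 *: (H *m W^T).
    rewrite -[in RHS](invmxK (H *m W^T)) -/X1 /invmx uX1 scalerA divff ?scale1r //.
    by rewrite -unitfE -unitmxE.
  rewrite -scalemxAr mulKmx // linearZ /= trmxK.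
  have -> : dsubmx (\det X1 *: W) = \det X1 *: W1.
    by rewrite linearZ /= col_mxKd.
  by rewrite eqmx_scale // -unitfE -unitmxE.
have {le1} : (gen_rank F a <= img_rank F (Zt t))%N.
  apply: leq_trans le1; rewrite -rZ0; apply: img_rankS.
  by rewrite /Zt /X subr0 scale1r scale0r addr0 col_mxKu.
have {le2} : (gen_rank G b <= img_rank G (Wt t))%N.
  by apply: leq_trans le2; rewrite -rW0; apply/img_rankS/(submx_trans W01).
have [p [Y [YZ <- _]]] := img_rankP F (Zt t).
have [q [U [UW <- _]]] := img_rankP G (Wt t).
move=> leG leF; apply: leq_trans (leq_add leF leG) _.
rewrite -(mxrank_tr (map_rows G U)); apply: mulmx0_rank_max.
apply/matrixP => i j; rewrite [RHS]mxE.
suff : F (row i Y) *m (G (row j U))^T = 0.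
  move=> FG; transitivity ((F (row i Y) *m (G (row j U))^T) 0 0).
    by rewrite !mxE; apply: eq_bigr => k _; rewrite !mxE.
  by rewrite FG mxE.
apply: FG0.
have /submxP[y ->] : (row i Y <= Zt t)%MS := submx_trans (row_sub _ _) YZ.
have /submxP[u ->] : (row j U <= Wt t)%MS := submx_trans (row_sub _ _) UW.
by rewrite trmx_mul !mulmxA -(mulmxA y) -(mulmxA y) ZW0 mulmx0 mul0mx.
Qed.

End Superadditivity.

(** * Polynomials as functions, and linear independence *)

Section MPolyEval.

Variable K : numFieldType.

(* Dedekind's independence of the multiplicative functions
   [v |-> \prod_i v i ^+ m i]; distinct ones differ at some point with
   coordinates in {1, 2}. *)
Lemma monomials_independent n (s : seq 'X_{1..n}) (c : 'X_{1..n} -> K) :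
  uniq s ->
  (forall v : 'I_n -> K, \sum_(m <- s) c m * \prod_i v i ^+ m i = 0) ->
  forall m, m \in s -> c m = 0.
Proof.
elim: s c => // m0 s IHs c /= /andP[m0s us] c0.
have cs m : m \in s -> c m = 0.
  move=> ms; have [i mi] : exists i, m i != m0 i.
    apply/existsP; apply: contraNT m0s => /existsPn mm0.
    suff <- : m = m0 by [].
    by apply/mnmP => i; apply/eqP/negbNE/mm0.
  pose u k : K := if k == i then 2 else 1.
  have uE (m1 : 'X_{1..n}) : \prod_k u k ^+ m1 k = 2 ^+ m1 i.
    rewrite (bigD1 i) //= /u eqxx big1 ?mulr1 // => k /negPf ->.
    by rewrite expr1n.
  (* The relation at [u * v] minus [2 ^+ m0 i] times the relation at [v] has no [m0] term, so
     induction applies. *)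
  have: c m * (2 ^+ m i - 2 ^+ m0 i) = 0.
    apply: (IHs (fun m => c m * (2 ^+ m i - 2 ^+ m0 i))) ms => // v.
    have : \sum_(m <- m0 :: s)
        c m * (2 ^+ m i - 2 ^+ m0 i) * \prod_k v k ^+ m k = 0.
      transitivity
        (\sum_(m <- m0 :: s) c m * \prod_k (u k * v k) ^+ m k -
         2 ^+ m0 i * \sum_(m <- m0 :: s) c m * \prod_k v k ^+ m k); last first.
        by rewrite !c0 mulr0 subr0.
      rewrite mulr_sumr -sumrB.
      apply: eq_bigr => m1 _.
      have -> : \prod_k (u k * v k) ^+ m1 k = 2 ^+ m1 i * \prod_k v k ^+ m1 k.
        by rewrite -uE -big_split; apply: eq_bigr => k _; rewrite exprMn.
      by rewrite mulrBr mulrBl !mulrA (mulrC (c m1) (2 ^+ m0 i)).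
    by rewrite big_cons subrr mulr0 mul0r add0r.
  move/eqP; rewrite mulf_eq0 subr_eq0 => /predU1P[//|/eqP e2].
  have := mi; suff -> : m i = m0 i by rewrite eqxx.
  by apply: (@ieexprIn K 2) => //; rewrite ?ltr0n // -[1]/(1%:R) eqr_nat.
move=> m; rewrite inE => /predU1P[->|]; last exact: cs.
have := c0 (fun _ => 1); rewrite big_cons [X in _ + X]big_seq.
rewrite [X in _ + X]big1 => [|m1 m1s].
  by rewrite addr0 big1 ?mulr1 // => i _; rewrite expr1n.
by rewrite cs // mul0r.
Qed.

Lemma meval_eq0 n (p : {mpoly K[n]}) : (forall v, p.@[v] = 0) -> p = 0.
Proof.
move=> p0; apply/mpolyP => m; rewrite mcoeff0.
have [mp|/memN_msupp_eq0 //] := boolP (m \in msupp p).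
apply: (@monomials_independent _ _ (fun m => p@_m) (msupp_uniq p)) mp => v.
by rewrite -mevalE.
Qed.

(** A nonzero column of [cokermx B] would be a linear relation among the [P k], by [meval_eq0]. *)
Lemma gen_rank_lin_indep n N (P : 'I_N -> {mpoly K[n]}) :
  lin_indep P -> gen_rank (fun v => \row_k (P k).@[v 0]) n = N.
Proof.
move=> indP; set F := (fun v => _); rewrite gen_rank_full.
have [p [X [_ <- FX]]] := img_rankP F 1%:M; set B := map_rows F X.
suff /eqP: \rank (cokermx B) = 0%N.
  rewrite mxrank_coker subn_eq0 => NB.
  by apply/eqP; rewrite eqn_leq rank_leq_col.
apply/eqP; rewrite mxrank_eq0; apply/eqP/matrixP => k j; rewrite [RHS]mxE.
apply: (indP (fun k => cokermx B k j)); apply: meval_eq0 => v.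
have /eqP FB0 : F (\row_i v i) *m cokermx B == 0.
  by rewrite -submxE FX ?submx1.
transitivity ((F (\row_i v i) *m cokermx B) 0 j); last by rewrite FB0 mxE.
rewrite mxE raddf_sum; apply: eq_bigr => i _ /=.
rewrite mevalZ [F _ 0 i]mxE mulrC; congr (_ * _).
by apply: meval_eq => l; rewrite mxE.
Qed.

End MPolyEval.

(** * The combinatorial dichotomy for superadditive sequences *)

Section Dichotomy.

(** Doubling avoids halves. Subtraction is truncated: the last product vanishes for [k <= j] and
    otherwise corrects for the part of the triangle not yet summed. *)
Lemma sum_minn_triangle k j :
  (2 * (\sum_(i < j) minn k.+1 i.+1) + k * k.+1
   = 2 * (j * k.+1) + (k - j) * (k - j).+1)%N.
Proof.
elim: j => [|j IHj]; first by rewrite big_ord0; lia.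
rewrite big_ord_recr /=; move: (\sum_(i < j) _)%N IHj => S IHj.
case: (leqP k j) => kj.
  have -> : minn k.+1 j.+1 = k.+1 by lia.
  have [kj0 kj1] : (k - j = 0 /\ k - j.+1 = 0)%N by lia.
  by move: IHj; rewrite kj0 kj1; nia.
have -> : minn k.+1 j.+1 = j.+1 by lia.
have [d kE] : exists d, k = (j + d.+1)%N by exists (k - j.+1)%N; lia.
have [kj0 kj1] : (k - j = d.+1 /\ k - j.+1 = d)%N by lia.
by move: IHj; rewrite kj0 kj1 kE; nia.
Qed.

Lemma leq_add_steps (s : nat -> nat) k m n : (m <= n)%N ->
  (forall j, (m <= j < n)%N -> (s j.+1 <= s j + k)%N) ->
  (s n <= s m + k * (n - m))%N.
Proof.
elim: n => [|n IHn]; first by rewrite leqn0 => /eqP ->; rewrite leq_addr.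
rewrite leq_eqVlt => /predU1P[->|]; first by rewrite leq_addr.
rewrite ltnS => mn step; rewrite subSn // mulnS addnC -addnA.
apply: leq_trans (step n _) _; first by rewrite mn ltnSn.
rewrite addnC leq_add2l addnC; apply: IHn => // j /andP[mj jn].
by apply: step; rewrite mj ltnS ltnW.
Qed.

(* With [m] the last index at which [s] jumps by more than [k]: if
   [n <= 2 * m] then [s] is large at both [m] and [n - m]; otherwise the increments
   of [s] are at most [k] on average. *)
Lemma superadditive_dichotomy (s : nat -> nat) n :
  (forall a b, (a + b)%N = n -> (s a + s b <= s n)%N) ->
  (forall m k, (m < n)%N -> (s m + k <= s m.+1)%N ->
     forall j, (j <= m.+1)%N -> (\sum_(i < j) minn k i.+1 <= s j)%N) ->
  forall k, (s n <= k * n)%N \/ (k.+1 * n <= s n + k * k.+1)%N.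
Proof.
move=> supS jump k.
pose P m := (0 < m <= n)%N && (s m.-1 + k.+1 <= s m)%N.
have [exP|noP] := boolP [exists m : 'I_n.+1, P m]; last first.
  (* Superadditivity at [0 + n] forces [s 0 = 0], and here no increment exceeds [k]. *)
  left; have := supS 0%N n (add0n n).
  rewrite -{2}(add0n (s n)) leq_add2r leqn0 => /eqP s0.
  rewrite -[leqLHS]/(s n) -(add0n (k * n)%N) -s0 -{2}(subn0 n).
  apply: leq_add_steps => // j /andP[_ jn]; rewrite leqNgt.
  apply: contra noP => sj; apply/existsP.
  by exists (Ordinal (jn : j.+1 < n.+1)%N); rewrite /P /= jn addnS.
have {}exP : exists m, P m by case/existsP: exP => m; exists m.
have ubP m : P m -> (m <= n)%N by case/andP => /andP[].
case: (ex_maxnP exP ubP) => m /andP[/andP[m0 mn] sm] maxm.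
have mS : m.-1.+1 = m by rewrite prednK.
have large j : (j <= m)%N -> (j * k.+1 * 2 <= 2 * s j + k * k.+1)%N.
  move=> jm; have := @jump m.-1 k.+1; rewrite mS => /(_ mn sm j jm).
  by have := sum_minn_triangle k j; lia.
have small i : (m <= i <= n)%N -> (s n <= s i + k * (n - i))%N.
  move=> /andP[mi iN]; apply: leq_add_steps => // j /andP[ij jn].
  rewrite leqNgt; apply/negP => sj.
  have := maxm j.+1; rewrite /P /= jn addnS sj => /(_ isT).
  by rewrite leqNgt ltnS (leq_trans mi ij).
have := supS m (n - m)%N (subnKC mn).
(* In the first case [large] applies at both [m] and [n - m]. In the second, [small] at both gives
   [2 * s n <= s m + s (n - m) + k * n], and superadditivity cancels one [s n]. *)
have [nm|nm] := leqP (n - m) m; [right|left].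
  by have := large _ nm; have := large _ (leqnn m); nia.
have := small m; rewrite leqnn mn => /(_ isT).
have := small (n - m)%N; rewrite (ltnW nm) leq_subr subKn // => /(_ isT).
by nia.
Qed.

End Dichotomy.

(** * Polarization of the rank decomposition *)

Section HermitianRank.

Variables (C : numClosedFieldType) (n : nat).
Implicit Type herm : {hermitian 'rV[C]_n for false & Num.conj}.

Definition conj_vec (w : 'rV[C]_n) : 'rV[C]_n := map_mx Num.conj w.

Definition gram herm : 'M[C]_n :=
  \matrix_(i, j) herm 'e_i 'e_j.

Lemma gramE herm (u v : 'rV[C]_n) :
  herm u v = (u *m gram herm *m (conj_vec v)^T) 0 0.
Proof.
rewrite [X in herm X _](row_sum_delta u) linear_sumlz -mulmxA mxE.
apply: eq_bigr => i _; rewrite linearZl_LR /=; congr (_ * _).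
rewrite [X in herm _ X](row_sum_delta v) linear_sumr mxE.
by apply: eq_bigr => j _; rewrite linearZr_LR !mxE mulrC.
Qed.

Lemma gram_unit herm : nondegenerate herm -> gram herm \in unitmx.
Proof.
move=> nd; rewrite -row_free_unit -kermx_eq0; apply/negPn/negP => /rowV0Pn[v].
move=> /sub_kermxP vH; apply/negP/negPn; rewrite -memv0 -(eqP nd).
by apply/mem_orthovP => u _; rewrite gramE vH mul0mx mxE.
Qed.

Lemma meval_sqnorm_poly herm (z w : 'rV[C]_n) :
  (sqnorm_poly herm).@[row_mx z w 0] = (z *m gram herm *m w^T) 0 0.
Proof.
rewrite -mulmxA mxE /sqnorm_poly raddf_sum; apply: eq_bigr => i _ /=.
rewrite raddf_sum mxE mulr_sumr; apply: eq_bigr => j _ /=.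
by rewrite mevalZ mevalM !mevalXU row_mxEl row_mxEr !mxE mulrCA.
Qed.

Lemma eval_zzbarE (P : {mpoly C[n + n]}) z :
  eval_zzbar P z = P.@[row_mx z (conj_vec z) 0].
Proof.
apply: meval_eq => k; rewrite /polarpt; case: (split_ordP k) => j ->.
  by rewrite row_mxEl.
by rewrite row_mxEr mxE.
Qed.

(* Polarization: [z = a + 'i b] and [w = conj a + 'i conj b] are the value at
   ['i] of a polynomial curve whose points at real parameters [t] have the form
   [(a + t b, conj (a + t b))]. *)
Lemma polarization (f : 'rV[C]_n -> 'rV[C]_n -> C) :
  (forall x y : C -> 'rV[C]_n, polycurve x -> polycurve y ->
     polyfun (fun t => f (x t) (y t))) ->
  (forall z, f z (conj_vec z) = 0) -> forall z w, f z w = 0.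
Proof.
move=> fP f0 z w.
pose a := 2^-1 *: (z + conj_vec w); pose b := (2 * 'i)^-1 *: (z - conj_vec w).
pose x (t : C) := a + t *: b; pose y (t : C) := conj_vec a + t *: conj_vec b.
have lineP (u v : 'rV[C]_n) : polycurve (fun t => u + t *: v).
  apply: polycurveD; first exact: polycurve_cst.
  by apply: polycurveZ; [apply: polyfun_id | apply: polycurve_cst].
have fxy0 : forall t, f (x t) (y t) = 0.
  apply: polyfun_eq0 => [|k]; first by apply: fP; apply: lineP.
  suff -> : y k%:R = conj_vec (x k%:R) by apply: f0.
  by apply/matrixP => i j; rewrite !mxE !(rmorphD, rmorphM) /= rmorph_nat.
have i0 : 'i != 0 :> C by apply: neq0Ci.
have xi : x 'i = z.
  by apply/matrixP => i j; rewrite !mxE; field.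
have yi : y 'i = w.
  apply/matrixP => i j; rewrite !mxE !(rmorphM, rmorphB, rmorphD, fmorphV) /=.
  by rewrite conjCK conjCi rmorph1; field.
by rewrite -(fxy0 'i) xi yi.
Qed.

Lemma has_rankP (P : {mpoly C[n + n]}) r : has_rank P r ->
  exists (f : 'I_r -> {mpoly C[n]}) (e : 'I_r -> C),
    [/\ lin_indep f, forall k, e k != 0
      & forall z, eval_zzbar P z = \sum_k e k * `|eval_z (f k) z| ^+ 2].
Proof.
move=> [p [q [Pp [Pm [-> ind PE]]]]].
exists (fun k => match split k with inl a => Pp a | inr b => Pm b end).
exists (fun k => if split k is inl _ then 1 else -1).
split=> [c c0 k||z].
- rewrite -(splitK k); apply: (ind (fun i => c (unsplit i))).
  rewrite big_sumType -[RHS]c0 big_split_ord; congr (_ + _).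
    by apply: eq_bigr => i _; rewrite -[lshift q i]/(unsplit (inl i)) unsplitK.
  by apply: eq_bigr => i _; rewrite -[rshift p i]/(unsplit (inr i)) unsplitK.
- by move=> k; case: split => _; rewrite ?oppr_eq0 oner_neq0.
- rewrite PE big_split_ord -sumrN; congr (_ + _).
    apply: eq_bigr => i _.
    by rewrite -[lshift q i]/(unsplit (inl i)) unsplitK mul1r.
  apply: eq_bigr => i _.
  by rewrite -[rshift p i]/(unsplit (inr i)) unsplitK mulN1r.
Qed.

(** Conjugating both argument and value conjugates the coefficients of [F], so the result is
    polynomial in [w]; the diagonal factor carries the signs of the decomposition. *)
Definition conj_map N (e : 'I_N -> C) (F : 'rV[C]_n -> 'rV[C]_N) (w : 'rV[C]_n)
    : 'rV[C]_N :=
  map_mx Num.conj (F (conj_vec w)) *m diag_mx (\row_k e k).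

Lemma conj_vecK (w : 'rV[C]_n) : conj_vec (conj_vec w) = w.
Proof. by apply/matrixP => i j; rewrite !mxE conjCK. Qed.

Lemma polymap_conj N (e : 'I_N -> C) (F : 'rV[C]_n -> 'rV[C]_N) :
  polymap F -> polymap (conj_map e F).
Proof.
move=> FP; apply: polymap_mulr => j; have [p Fp] := FP j.
exists (\sum_(m <- msupp p) (p@_m)^* *: 'X_[m]) => v.
rewrite mxE Fp mevalE !raddf_sum; apply: eq_bigr => m _ /=.
rewrite mevalZ mevalX rmorphM rmorph_prod; congr (_ * _).
by apply: eq_bigr => i _; rewrite rmorphXn /= mxE conjCK.
Qed.

(** Conjugation preserves ranks and inclusions, and a diagonal matrix with nonzero entries is
    invertible, so the conjugate of an optimal subspace serves for [conj_map]. *)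
Lemma gen_rank_conj N (e : 'I_N -> C) (F : 'rV[C]_n -> 'rV[C]_N) j :
  (forall k, e k != 0) -> (gen_rank F j <= gen_rank (conj_map e F) j)%N.
Proof.
move=> e0; have [M <-] := gen_rankP F j; have [p [X [XM <- _]]] := img_rankP F M.
apply: leq_trans (gen_rank_ge _ (map_mx Num.conj M)).
have XM' : (map_mx Num.conj X <= map_mx Num.conj M)%MS by rewrite map_submx.
apply: leq_trans (img_rank_ge _ XM').
set E := diag_mx (\row_k e k).
have uE : row_free E.
  rewrite row_free_unit unitmxE det_diag unitfE; apply/prodf_neq0 => k _.
  by rewrite mxE.
have -> : map_rows (conj_map e F) (map_mx Num.conj X) =
          map_mx Num.conj (map_rows F X) *m E.
  apply/row_matrixP => i; rewrite row_map_rows row_mul -!map_row row_map_rows.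
  by rewrite /conj_map -/(conj_vec (row i X)) conj_vecK.
by rewrite mxrankMfree // mxrank_map.
Qed.

Lemma rank_sqnorm_mul_dichotomy herm (A : {mpoly C[n + n]}) r :
  (0 < n)%N -> nondegenerate herm -> A != 0 -> has_rank (A * sqnorm_poly herm) r ->
  (0 < r)%N /\
  forall k, (r <= k * n)%N \/ (k.+1 * n <= r + k * k.+1)%N.
Proof.
move=> n0 nd A0 /has_rankP[f [e [ind e0 rankE]]].
have uH := gram_unit nd; set H := gram herm in uH.
pose F (v : 'rV[C]_n) := \row_k (f k).@[v 0]; pose G := conj_map e F.
have FP : polymap F by move=> k; exists (f k) => v; rewrite mxE.
have GP : polymap G by apply: polymap_conj.
(* The decomposition gives this identity for [w = conj_vec z]; polarization frees [w]. *)
have FG z w : (F z *m (G w)^T) 0 0 = A.@[row_mx z w 0] * (z *m H *m w^T) 0 0.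
  rewrite -meval_sqnorm_poly -mevalM; apply/eqP; rewrite -subr_eq0; apply/eqP.
  move: z w; apply: polarization => [x y xP yP|z].
    apply: polyfunD.
      apply: (polycurveM (polymap_curve FP xP)).
      exact: polycurve_tr (polymap_curve GP yP).
    apply: polyfunN; apply: polyfun_meval => k.
    case: (split_ordP k) => j ->.
      by apply: eq_polyfun (xP 0 j) => t; rewrite row_mxEl.
    by apply: eq_polyfun (yP 0 j) => t; rewrite row_mxEr.
  apply/eqP; rewrite subr_eq0 -eval_zzbarE rankE; apply/eqP.
  rewrite mxE; apply: eq_bigr => k _.
  rewrite !mxE (bigD1 k) //= big1 => [|i ik]; last first.
    by rewrite !mxE (negPf ik) mulr0.
  by rewrite !mxE eqxx mulr1n addr0 conj_vecK normCK /eval_z [RHS]mulrC mulrA.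
have FG0 z w : z *m H *m w^T = 0 -> F z *m (G w)^T = 0.
  by move=> zw; apply/matrixP => i j; rewrite !ord1 FG zw !mxE mulr0.
split.
  (* For [r = 0] the identity makes [A * sqnorm_poly herm] vanish. Polynomials form an integral
     domain and [A] is nonzero, so the Gram matrix would be zero. *)
  rewrite lt0n; apply/eqP => r0.
  have Q0 : sqnorm_poly herm = 0.
    have /eqP : A * sqnorm_poly herm = 0.
      apply: meval_eq0 => x.
      pose z : 'rV[C]_n := \row_i x (lshift n i).
      pose w : 'rV[C]_n := \row_i x (rshift n i).
      have -> : (A * sqnorm_poly herm).@[x] =
                (A * sqnorm_poly herm).@[row_mx z w 0].
        apply: meval_eq => k; case: (split_ordP k) => j ->.
          by rewrite row_mxEl mxE.
        by rewrite row_mxEr mxE.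
      rewrite mevalM meval_sqnorm_poly -FG mxE big1 // => k _.
      by have := ltn_ord k; rewrite {2}r0.
    by rewrite mulf_eq0 (negPf A0) => /eqP.
  move: uH; suff -> : H = 0.
    by rewrite -row_free_unit /row_free mxrank0 eq_sym gtn_eqF.
  apply/matrixP => i j; rewrite [RHS]mxE.
  have := meval_sqnorm_poly herm 'e_i 'e_j.
  by rewrite Q0 meval0 -rowE trmx_delta -colE !mxE => <-.
have gF : gen_rank F n = r by apply: gen_rank_lin_indep.
have := @superadditive_dichotomy (gen_rank F) n; rewrite gF; apply.
- move=> a b abn;
  apply: leq_trans (gen_rank_orthogonal abn FP GP uH FG0).
  by rewrite leq_add2l; apply: gen_rank_conj.
- by move=> m k _; apply: gen_rank_sum_minn.
Qed.

End HermitianRank.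

(** * From the dichotomy to the gaps in the possible ranks *)

(** Climb through [k = 0, 1, ...]: once the lower bound for band [k] holds, the dichotomy at [k]
    either puts [r] in that band or gives the next lower bound. At [k = 0] the first alternative
    contradicts [0 < r]. *)
Lemma dichotomy_gaps n r k0 : (0 < r)%N ->
  (forall k, (r <= k * n)%N \/ (k.+1 * n <= r + k * k.+1)%N) ->
  (k0.+1 * n <= r + k0 * k0.+1)%N \/
  exists k, [/\ (0 < k <= k0)%N, (k * n <= r + k.-1 * k)%N & (r <= k * n)%N].
Proof.
move=> r0 dich; elim: k0 => [|j [lej|[k [kj lek rk]]]].
- by case: (dich 0%N) => [|le]; [lia | left].
- case: (dich j.+1) => [rj|]; last by left.
  by right; exists j.+1; rewrite /= leqnn lej rj.
- by right; exists k; split => //; lia.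
Qed.

Unset Implicit Arguments.

Theorem corollary1p3 (R : realType) (n : nat) (hn : (2 <= n)%N)
    (herm : {hermitian 'rV[R[i]]_n for false & Num.conj})
    (hnd : nondegenerate herm)
    (k0 : nat) (hk0 : ((k0 + 2) * (k0 + 1) <= n)%N)
    (hk0max : forall k : nat, ((k + 2) * (k + 1) <= n)%N -> (k <= k0)%N)
    (A : {mpoly R[i][n + n]}) (hA0 : A != 0) (hA : hermitian_poly A)
    (r : nat) (hr : has_rank (A * sqnorm_poly herm) r) :
  (k0%:Z + 1) * n%:Z - (k0%:Z + 1) * k0%:Z <= r%:Z
  \/ exists k : nat,
       [/\ (1 <= k <= k0)%N,
           k%:Z * n%:Z - k%:Z * (k%:Z - 1) <= r%:Z
         & r%:Z <= k%:Z * n%:Z + 2 * k%:Z].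
Proof.
have n0 : (0 < n)%N by apply: leq_trans hn.
have [r0 dich] := rank_sqnorm_mul_dichotomy n0 hnd hA0 hr.
have [le|[k [/andP[k_gt0 kk0] lek rk]]] := dichotomy_gaps k0 r0 dich.
  by left; nia.
(* The bound [r <= k * n] obtained here implies the stated upper bound. *)
by right; exists k; split; [lia | nia | nia].
Qed.
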